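(* For every $n\ge 8$, $\mu(M(C_n))=n+\left\lfloor \frac{n}{4}\right\rfloor$, where $C_n$ is the cycle on $n$ vertices.
   Context: All graphs are finite and simple. The Mycielskian $M(G)$ of a graph $G$ has vertex set $V(G)\cup V(G')\cup\{v^*\}$, where $V(G')=\{u': u\in V(G)\}$, and edge set $E(G)\cup\{uv': uv\in E(G)\}\cup\{v'v^*: v'\in V(G')\}$ (so for each edge $uv$ of $G$ both $uv'$ and $vu'$ are edges). Given $S\subseteq V(H)$, two vertices $x,y$ are $S$-visible if some shortest $x,y$-path in $H$ has no internal vertex in $S$; $S$ is a mutual-visibility set if every two vertices of $S$ are $S$-visible; $\mu(H)$ is the maximum size of a mutual-visibility set of $H$. *)

(* Defs.v *)
From mathcomp Require Import all_boot.
From mathcomp Require Import boolp.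
Set Implicit Arguments.
Unset Strict Implicit.
Unset Printing Implicit Defensive.

Record sgraph := SGraph {
  vertex :> finType;
  adj : rel vertex;
  adj_sym : symmetric adj;
  adj_irrefl : irreflexive adj }.

(* The guard i != j is redundant for n >= 3; it only makes the degenerate
   cases n <= 2 loopless. *)
Definition cycle_rel (n : nat) : rel 'I_n :=
  fun i j => (i != j) && ((ordS i == j) || (ordS j == i)).

Lemma cycle_rel_sym n : symmetric (@cycle_rel n).
Proof. by move=> i j; rewrite /cycle_rel eq_sym orbC. Qed.

Lemma cycle_rel_irrefl n : irreflexive (@cycle_rel n).
Proof. by move=> i; rewrite /cycle_rel eqxx. Qed.

Definition cycle_graph (n : nat) : sgraph :=
  SGraph (@cycle_rel_sym n) (@cycle_rel_irrefl n).

(* Some (inl u) is the vertex u of G, Some (inr u) is its copy u', and None is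
   the vertex v^*. *)
Definition mycielskian_rel (G : sgraph) : rel (option (G + G)) :=
  fun x y => match x, y with
  | Some (inl u), Some (inl v) => adj u v
  | Some (inl u), Some (inr v) => adj u v
  | Some (inr u), Some (inl v) => adj u v
  | Some (inr _), None => true
  | None, Some (inr _) => true
  | _, _ => false
  end.

Lemma mycielskian_rel_sym G : symmetric (@mycielskian_rel G).
Proof. by move=> [[u|u]|] [[v|v]|] //=; rewrite adj_sym. Qed.

Lemma mycielskian_rel_irrefl G : irreflexive (@mycielskian_rel G).
Proof. by move=> [[u|u]|] //=; rewrite adj_irrefl. Qed.

Definition mycielskian (G : sgraph) : sgraph :=
  SGraph (@mycielskian_rel_sym G) (@mycielskian_rel_irrefl G).

Section MutualVisibility.
Variable H : sgraph.
Implicit Types (x y : H) (p : seq H) (S : {set H}).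

(* The sequence of vertices of the path is x :: p. *)
Definition is_path x y p : Prop :=
  [/\ path (@adj H) x p, uniq (x :: p) & last x p = y].

Definition is_shortest_path x y p : Prop :=
  is_path x y p /\ forall q, is_path x y q -> size p <= size q.

Definition internal_vertices x p : seq H := behead (belast x p).

Definition visible S x y : Prop :=
  exists p, is_shortest_path x y p /\
    forall z, z \in internal_vertices x p -> z \notin S.

Definition mutual_visibility_set S : Prop :=
  forall x y, x \in S -> y \in S -> x != y -> visible S x y.

Definition mu : nat :=
  \max_(S : {set H} | `[< mutual_visibility_set S >]) #|S|.

End MutualVisibility.

(* Main.v *)
(* Write S = A + B' + T with A the vertices of the cycle in S, B the indices of
   the copies in S and T a subset of {v*}; let P be the complement of B.

   Lower bound: if A is independent, v* is not in S and every i in A has a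
   cycle neighbour in P, then S is a mutual-visibility set, because far pairs see
   each other through v* and near pairs along the cycle.  Take A = {4t, 4t + 2}
   and P = {4t + 1} for t < n / 4.

   Upper bound: if v* is in S, then any two copies in S are at cycle distance 2,
   so |B| <= 2, and A is not everything.  If v* is not in S and some i in A has
   both copies i - 1, i + 1 in S, then all of S lies within cycle distance 4 of i
   and |S| <= 10.  Otherwise visibility at distances 2 and 3 restricts
   the patterns of A and P, so that among any four consecutive indices A exceeds
   P by at most one, except on the pattern where A is 1001 and P is empty; there
   the excess is two, and the next window has excess zero.  Averaging over all
   windows gives |A| - |P| <= n / 4. *)
Require Import Defs.
From mathcomp Require Import all_boot all_algebra boolp zify.
Set Implicit Arguments.
Unset Strict Implicit.
Unset Printing Implicit Defensive.
Import GRing.Theory.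

(** * Visibility in terms of walks *)

Section Visibility.
Variable H : sgraph.
Implicit Types (x y : H) (p q : seq H) (S : {set H}).

(** Any explicit walk [q] bounds the distance, so using visibility reduces to enumerating walks of a
    small known length. *)
Lemma visible_short_walk S x y q :
    visible S x y -> path (@adj H) x q -> last x q = y ->
  exists p, [/\ path (@adj H) x p, last x p = y, size p <= size q
    & all (fun z => z \notin S) (behead (belast x p))].
Proof.
move=> [p [[[xp _ py] minp] intp]] xq qy; exists p; split=> //.
  2: exact/allP.
case: (shortenP xq) qy => q' xq' uq' sq' q'y.
apply: leq_trans (minp q' _) _ => //.
by apply: uniq_leq_size sq'; case/andP: uq'.
Qed.

(** A walk of minimal length repeats no vertex, since otherwise shortening it would give a strictly
    shorter one. *)
Lemma visible_of_minimal_walk S x y p :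
    path (@adj H) x p -> last x p = y ->
    (forall q, path (@adj H) x q -> last x q = y -> size p <= size q) ->
    (forall z, z \in internal_vertices x p -> z \notin S) ->
  visible S x y.
Proof.
move=> xp py minp intp; exists p; split=> //; split; last first.
  by move=> q [xq _ qy]; apply: minp.
split=> //; case: (shortenP xp) py => q xq uq sq qy.
apply: (leq_size_uniq uq); last by rewrite /= ltnS minp.
by move=> z; rewrite !inE => /predU1P[->|/sq->]; rewrite ?eqxx ?orbT.
Qed.

Lemma visible_sym S x y : visible S x y -> visible S y x.
Proof.
have rev_walk a b p : path (@adj H) a p -> last a p = b ->
    path (@adj H) b (rev (belast a p)) /\ last b (rev (belast a p)) = a.
  move=> ap <-; rewrite rev_path (eq_path (e' := @adj H)) => [|u v]; last exact: adj_sym.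
  by split=> //; case: p {ap} => //= c p; rewrite rev_cons last_rcons.
move=> [p [[[xp _ py] minp] intp]].
have [yp' p'x] := rev_walk _ _ _ xp py.
apply: (visible_of_minimal_walk yp' p'x) => [q yq qx|z].
  have [xq' q'y] := rev_walk _ _ _ yq qx.
  case: (shortenP xq') q'y => q1 xq1 uq1 sq1 q1y.
  rewrite size_rev size_belast (leq_trans (minp q1 _)) //.
  have /andP[_ /uniq_leq_size/(_ sq1)] := uq1.
  by rewrite size_rev size_belast.
move=> zin; apply: intp; move: zin {xp py minp yp' p'x}.
case/lastP: p => //= p b; rewrite /internal_vertices belast_rcons rev_cons.
by rewrite belast_rcons /= mem_rev.
Qed.

End Visibility.

(** * Patterns on four consecutive indices, and counting *)

(* c marks the exceptional windows; the terms c 0 and c 1 cancel when the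
   inequality is summed around the cycle. *)
Lemma window_bound (a p : nat -> bool)
    (c := fun k => [&& a k, ~~ a k.+1, ~~ a k.+2, a k.+3,
                      ~~ p k, ~~ p k.+1, ~~ p k.+2 & ~~ p k.+3]) :
    (forall k, a k.+1 ==> (p k || p k.+2)) ->
    (forall k, a k.+1 && a k.+2 ==> (p k && p k.+3)) ->
    (forall k, [&& a k, a k.+1 & a k.+3] ==> p k.+1) ->
    (forall k, [&& a k, a k.+2 & a k.+3] ==> p k.+2) ->
  a 1 + a 2 + a 3 + a 4 + c 0 <= 1 + c 1 + (p 1 + p 2 + p 3 + p 4).
Proof.
rewrite /c => h1 h2 h3 h4.
(* A finite check on indices 0 to 5. If [c 0] holds, [a 3] forces [p 4] and excludes [a 4], so this
   window has excess zero. *)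
move: (h1 0) (h1 1) (h1 2) (h1 3) (h2 0) (h2 1) (h2 2) (h3 1) (h4 1) => {h1 h2 h3 h4}.
case: (a 1); case: (a 2); case: (a 3); case: (a 4) => //=;
  case: (p 1); case: (p 2); case: (p 3); case: (p 4) => //=;
  by case: (p 0); case: (p 5); case: (a 0).
Qed.

Lemma card_le_count (T : finType) (A : {set T}) (s : seq T) :
  {subset A <= s} -> #|A| <= count (mem A) s.
Proof.
move=> sAs; rewrite cardE -size_filter uniq_leq_size ?enum_uniq // => x.
by rewrite mem_enum mem_filter => xA; apply/andP; split; last exact: sAs.
Qed.

Lemma card_option_sum (T1 T2 : finType) (S : {set option (T1 + T2)}) :
  #|S| = (None \in S) + #|[set i | Some (inl i) \in S]|
         + #|[set i | Some (inr i) \in S]|.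
Proof.
have SomeE : S :\ None = Some @: [set x | Some x \in S].
  apply/setP=> -[x|]; rewrite !inE /=.
    by rewrite mem_imset ?inE // => y z [].
  by apply/esym/imsetP => -[].
rewrite (cardsD1 None) SomeE card_imset => [|x y []//].
by rewrite -addnA -!sum1_card big_sumType /=; congr (_ + (_ + _)); apply: eq_bigl => i; rewrite !inE.
Qed.

(** * Indices modulo n, and walks in the Mycielskian of the cycle *)

Section CycleMycielskian.
Variable m : nat.
Hypothesis n_ge8 : 8 <= m.+2.
Local Notation C := (cycle_graph m.+2).
Local Notation M := (mycielskian C).

Local Notation u i := (Some (inl i) : M).
Local Notation u' i := (Some (inr i) : M).
Local Notation "'v*'" := (None : M).

(** Integer offsets turn a coincidence of nearby vertices into a linear equation over the
    integers. *)
Definition shift (i : 'I_m.+2) (z : int) : 'I_m.+2 := (i + 1 *~ z)%R.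

Lemma shift0 i : shift i 0 = i.
Proof. by rewrite /shift mulr0z addr0. Qed.

Lemma shiftD i y z : shift (shift i y) z = shift i (y + z)%R.
Proof. by rewrite /shift mulrzDr addrA. Qed.

Lemma shift_inj z : injective (shift^~ z).
Proof. exact: addIr. Qed.

Lemma intr_Zp_eq0 (z : int) : (1 *~ z = 0 :> 'I_m.+2)%R -> (absz z < 8)%N -> z = 0%R.
Proof.
have nat_eq0 k : (1 *+ k = 0 :> 'I_m.+2)%R -> (k < 8)%N -> k = 0%N.
  move=> /(congr1 val); rewrite Zp_nat /= => kn k8.
  by rewrite modn_small ?(leq_trans k8) in kn.
case: z => k /=; first by move=> /nat_eq0 h /h ->.
by move=> /eqP; rewrite NegzE mulrNz oppr_eq0 => /eqP /nat_eq0 h /h.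
Qed.

(** Offsets less than 8 apart cannot be congruent modulo n, as n is at least 8. *)
Lemma shift_eq i y z : shift i y = shift i z -> (absz (y - z) < 8)%N -> y = z.
Proof.
move=> /addrI e /intr_Zp_eq0 h; apply/eqP; rewrite -subr_eq0 h //.
by rewrite mulrzBr e subrr.
Qed.

Lemma cycle_adjE (i j : 'I_m.+2) :
  @cycle_rel m.+2 i j = (j == shift i 1) || (j == shift i (-1)).
Proof.
have ordSE (k : 'I_m.+2) : ordS k = shift k 1.
  by apply: val_inj; rewrite /= modnDmr addn1.
rewrite /cycle_rel !ordSE [shift i 1 == j]eq_sym.
have -> : (shift j 1 == i) = (j == shift i (-1)).
  by rewrite -(inj_eq (@shift_inj (-1)%R)) shiftD shift0.
case: eqP => //= <-; rewrite -[X in (X == _) || (X == _)]shift0.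
apply/esym/negbTE/norP; split; apply/eqP => /shift_eq; by move=> /(_ isT).
Qed.

Lemma cycle_adjP (i j : 'I_m.+2) :
  @cycle_rel m.+2 i j -> j = shift i 1 \/ j = shift i (-1).
Proof. by rewrite cycle_adjE => /orP[]/eqP; [left|right]. Qed.

Lemma Some_inl_inj (A B : Type) (i j : A) :
  Some (inl i) = Some (inl j) :> option (A + B) -> i = j.
Proof. by case. Qed.

Lemma Some_inr_inj (A B : Type) (i j : B) :
  Some (inr i) = Some (inr j) :> option (A + B) -> i = j.
Proof. by case. Qed.

(* Turns the edges of an explicit walk into equations between shifts of one
   vertex, and refutes those whose offsets differ. *)
Ltac walk_step :=
  match goal with
  | H : is_true (_ && _) |- _ => case/andP: H => ? ?
  | H : _ /\ _ |- _ => case: H => ? ?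
  | H : is_true (@cycle_rel _ _ _) |- _ =>
      destruct (cycle_adjP H); clear H
  | H : Some (inl _) = Some (inl _) |- _ => apply Some_inl_inj in H
  | H : Some (inr _) = Some (inr _) |- _ => apply Some_inr_inj in H
  | H : Some _ = _ |- _ => discriminate
  | H : None = _ |- _ => discriminate
  | H : is_true false |- _ => discriminate
  | H : context [shift (shift _ _) _] |- _ => rewrite !shiftD in H
  | H : shift ?i ?y = shift ?i ?z |- _ =>
      apply shift_eq in H; [try (exfalso; lia) | lia]
  end.

Ltac walk := rewrite /= ?andbT; intros; subst;
  repeat (walk_step; subst).

(** Closes the surviving walks: the interior gives the required non-membership or meets a known
    element of [S], or the end has the required offset. *)
Ltac walk_end :=
  rewrite ?shiftD;
  match goal with
  | H : is_true (_ \notin _) |- is_true (_ \notin _) => exact H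
  | H : is_true (_ \notin _), K : is_true (_ \notin _) |- _ /\ _ =>
      exact (conj H K)
  | H : is_true (?x \notin _), K : is_true (_ \in _) |- _ =>
      by case: (negP (H : ~~ (x \in _)) K)
  | |- exists2 z, shift ?i ?y = shift ?i z & _ => by exists y
  | H : shift _ _ <> shift _ _ |- _ => by case: H
  | |- _ \/ _ => first [by left | by right]
  end.

(* Keeps injection and conversion from unfolding shift to arithmetic on nat. *)
Opaque shift.

(** * What visibility forces near a vertex *)

Section Rules.
Variable S : {set M}.

(** The only walk of length at most 2 between these vertices has [u (shift i e)] in the middle. *)
Lemma visible_dist2 i (e : int) : (e = 1 \/ e = -1)%R ->
  visible S (u i) (u' (shift i (e + e))) -> u (shift i e) \notin S.
Proof.
move=> he /(@visible_short_walk _ _ _ _ [:: u (shift i e); u' (shift i (e + e))]).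
case=> [|//|p [xp py szp intp]].
  by rewrite /= !cycle_adjE !shiftD; case: he => ->; rewrite !eqxx ?orbT.
(* With [i] written as a shift by 0, all vertices to be compared are shifts of [i]. *)
move: xp py szp intp; rewrite -{1 2 4}(shift0 i).
case: he => ->; case: p => [|[[k|k]|] [|[[l|l]|] [|? ?]]] //=; walk.
all: walk_end.
Qed.

(** A walk of length 3 advances by [e] at each step and never uses two copies in a row; avoiding
    [u (shift i e)], it takes the copy there and then the original. *)
Lemma visible_dist3 i (e : int) : (e = 1 \/ e = -1)%R ->
    visible S (u i) (u (shift i (e + e + e))) -> u (shift i e) \in S ->
  u' (shift i e) \notin S /\ u (shift i (e + e)) \notin S.
Proof.
move=> he /(@visible_short_walk _ _ _ _
  [:: u (shift i e); u (shift i (e + e)); u (shift i (e + e + e))]).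
case=> [|//|p [xp py szp intp]].
  by rewrite /= !cycle_adjE !shiftD; case: he => ->; rewrite !eqxx ?orbT.
move: xp py szp intp; rewrite -{1 2 4}(shift0 i).
case: he => ->; case: p => [|[[k|k]|] [|[[l|l]|] [|[[r|r]|] [|? ?]]]] //=; walk.
all: walk_end.
Qed.

(** Both copies beside [i] block the route through [v*]; every other walk of length 3 reaches its
    end from [u (shift i (e + e))]. *)
Lemma visible_dist3' i (e : int) : (e = 1 \/ e = -1)%R ->
    visible S (u i) (u' (shift i (e + e + e))) ->
    u' (shift i 1) \in S -> u' (shift i (-1)) \in S ->
  u (shift i (e + e)) \notin S.
Proof.
move=> he /(@visible_short_walk _ _ _ _
  [:: u (shift i e); u (shift i (e + e)); u' (shift i (e + e + e))]).
case=> [|//|p [xp py szp intp]].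
  by rewrite /= !cycle_adjE !shiftD; case: he => ->; rewrite !eqxx ?orbT.
move: xp py szp intp; rewrite -{1 2 4}(shift0 i).
case: he => ->; case: p => [|[[k|k]|] [|[[l|l]|] [|[[r|r]|] [|? ?]]]] //=; walk.
all: walk_end.
Qed.

(** The route through [v*] caps the distance at 3 but is blocked, and each step avoiding [v*] moves
    the index by one. *)
Lemma visible_copy_near i j :
    visible S (u i) (u' j) ->
    u' (shift i 1) \in S -> u' (shift i (-1)) \in S ->
  exists2 z : int, j = shift i z & (absz z <= 3)%N.
Proof.
move=> /(@visible_short_walk _ _ _ _ [:: u' (shift i 1); v*; u' j]).
case=> [|//|p [xp py szp intp]]; first by rewrite /= !cycle_adjE eqxx.
move: xp py szp intp; rewrite -{1 2 4}(shift0 i).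
case: p => [|[[k|k]|] [|[[l|l]|] [|[[r|r]|] [|? ?]]]] //=; walk.
all: walk_end.
Qed.

(** The same argument, with a route of length 4 through [v*]. *)
Lemma visible_base_near i j :
    visible S (u i) (u j) ->
    u' (shift i 1) \in S -> u' (shift i (-1)) \in S ->
  exists2 z : int, j = shift i z & (absz z <= 4)%N.
Proof.
move=> /(@visible_short_walk _ _ _ _ [:: u' (shift i 1); v*; u' (shift j 1); u j]).
case=> [|//|p [xp py szp intp]].
  by rewrite /= andbT cycle_adjE eqxx cycle_rel_sym cycle_adjE eqxx.
move: xp py szp intp; rewrite -{1 2 4}(shift0 i).
case: p => [|[[k|k]|] [|[[l|l]|] [|[[r|r]|] [|[[s|s]|] [|? ?]]]]] //=; walk.
all: walk_end.
Qed.

(** With [v*] blocked, the middle vertex must be an original adjacent to both copies. *)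
Lemma visible_copies_dist2 i j : v* \in S -> i != j ->
    visible S (u' i) (u' j) ->
  j = shift i 2 \/ j = shift i (-2).
Proof.
move=> topS /eqP ij /(@visible_short_walk _ _ _ _ [:: v*; u' j]).
case=> [//|//|p [xp py szp intp]].
move: ij xp py szp intp; rewrite -{1 2 3}(shift0 i).
case: p => [|[[k|k]|] [|[[l|l]|] [|? ?]]] //=; walk.
all: walk_end.
Qed.
End Rules.

Lemma base_neq i j : i != j -> u i != u j.
Proof. by apply: contra => /eqP /= e; rewrite (Some_inl_inj e). Qed.

Lemma copy_neq i j : i != j -> u' i != u' j.
Proof. by apply: contra => /eqP /= e; rewrite (Some_inr_inj e). Qed.

(** * Upper bound *)

Section UpperBound.
Variable S : {set M}.
Hypothesis Svis : mutual_visibility_set S.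

Lemma base_pair_copy i (e : int) : (e = 1 \/ e = -1)%R ->
  u i \in S -> u (shift i e) \in S -> u' (shift i (e + e)) \notin S.
Proof.
move=> he ai ae; apply/negP => be.
by move/negP: (visible_dist2 he (Svis ai be isT)).
Qed.

Lemma base_triple i (e : int) : (e = 1 \/ e = -1)%R ->
    u i \in S -> u (shift i e) \in S -> u (shift i (e + e + e)) \in S ->
  u' (shift i e) \notin S /\ u (shift i (e + e)) \notin S.
Proof.
move=> he ai ae a3; apply: visible_dist3 => //; apply: Svis => //.
rewrite -{1}(shift0 i); apply/eqP => e3.
by have := shift_eq (Some_inl_inj e3); case: he => -> /(_ isT).
Qed.

Lemma apex_bound : v* \in S -> #|S| <= m.+2 + 2.
Proof.
move=> topS; rewrite card_option_sum topS.
set A := finset _; set B := finset _.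
have leB : #|B| <= 2.
  have [->|/set0Pn[i iB]] := eqVneq B set0; first by rewrite cards0.
  rewrite (cardsD1 i) iB ltnS.
  have far j : j \in B :\ i -> j = shift i 2 \/ j = shift i (-2).
    rewrite !inE => /andP[ji bj]; rewrite inE in iB.
    apply: (visible_copies_dist2 topS); first by rewrite eq_sym.
    by apply: Svis => //; apply: copy_neq; rewrite eq_sym.
  apply/card_le1_eqP => j k jB kB; case: (eqVneq j k) => // jk.
  have : k = shift j 2 \/ k = shift j (-2).
    move: jB kB; rewrite !inE => /andP[_ bj] /andP[_ bk].
    apply: (visible_copies_dist2 topS) => //.
    by apply: Svis => //; apply: copy_neq.
  (* The indices i - 2 and i + 2 differ by 4, and 4 is 2 or -2 modulo n only if n divides 2 or 6. *)
  move: jk; case: (far j jB) => ->; case: (far k kB) => ->;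
  rewrite ?eqxx // !shiftD => _; by case=> /shift_eq/(_ isT).
have ltA : #|A| < m.+2.
  rewrite -[X in _ < X]card_ord -cardsT proper_card // properT.
  apply/negP => /eqP AT; have a i : u i \in S by have := in_setT i; rewrite -AT inE.
  (* Originals 0, 1 and 3 in [S] force original 2 out of [S]. *)
  have [] := @base_triple (ord0 : 'I_m.+2) 1%R (or_introl erefl) (a _) (a _) (a _).
  by rewrite a.
lia.
Qed.

(** [S] lies among 9 originals and 7 copies near [i]; six exclusions on disjoint groups of these
    each remove at least one, and 16 - 6 = 10. *)
Lemma isolated_bound i :
    v* \notin S -> u i \in S -> u' (shift i 1) \in S -> u' (shift i (-1)) \in S ->
  #|S| <= 10.
Proof.
move=> topS ai b1 bN1.
pose s : seq M := [seq u (shift i z) | z <- [:: -4; -3; -2; -1; 0; 1; 2; 3; 4]%R] ++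
  [seq u' (shift i z) | z <- [:: -3; -2; -1; 0; 1; 2; 3]%R].
apply: leq_trans (@card_le_count _ S s _) _.
  move=> [[j|j]|] xS; last by rewrite xS in topS.
  - have [z -> ez] : exists2 z : int, j = shift i z & (absz z <= 4)%N.
      have [->|ji] := eqVneq j i; first by exists 0%R; rewrite ?shift0.
      apply: visible_base_near b1 bN1 => //; apply: Svis => //.
      by apply: base_neq; rewrite eq_sym.
    rewrite mem_cat map_f //; move: ez; rewrite !inE; lia.
  - have [z -> ez] := visible_copy_near (Svis ai xS isT) b1 bN1.
    rewrite mem_cat orbC map_f //; move: ez; rewrite !inE; lia.
have a0 : u (shift i 0) \in S by rewrite shift0.
have pair (e x y z : int) : (e = 1 \/ e = -1)%R -> y = (x + e)%R -> z = (x + (e + e))%R ->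
    ~~ [&& u (shift i x) \in S, u (shift i y) \in S & u' (shift i z) \in S].
  move=> he -> ->; apply/and3P => -[ax ay bz].
  by have := base_pair_copy he ax; rewrite !shiftD => /(_ ay)/negP.
have skew (e x y : int) : (e = 1 \/ e = -1)%R -> x = (e + e)%R -> y = (e + e + e)%R ->
    ~~ ((u (shift i x) \in S) && (u' (shift i y) \in S)).
  move=> he -> ->; apply/andP => -[a2 b3].
  by have := visible_dist3' he (Svis ai b3 isT) b1 bN1; rewrite a2.
(* The first two instances exclude the originals at offsets 1 and -1; the other four each break up a
   pair or a triple. *)
have := @pair (-1)%R 1%R 0%R (-1)%R (or_intror erefl) erefl erefl.
have := @pair 1%R (-1)%R 0%R 1%R (or_introl erefl) erefl erefl.
have := @pair (-1)%R 4%R 3%R 2%R (or_intror erefl) erefl erefl.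
have := @pair 1%R (-4)%R (-3)%R (-2)%R (or_introl erefl) erefl erefl.
have := @skew 1%R 2%R 3%R (or_introl erefl) erefl erefl.
have := @skew (-1)%R (-2)%R (-3)%R (or_intror erefl) erefl erefl.
rewrite /= a0 b1 bN1 /= !andbT.
move=> h1 h2 h3 h4 /negbTE-> /negbTE->; move: h1 h2 h3 h4.
by repeat match goal with |- context [in_mem ?x ?A] => case: (in_mem x A) => //= end.
Qed.

Lemma sum_shift (F : 'I_m.+2 -> nat) z : \sum_i F (shift i z) = \sum_i F i.
Proof. by rewrite [RHS](reindex_inj (@shift_inj z)). Qed.

Lemma discharging_bound : v* \notin S ->
    (forall i, u i \in S -> (u' (shift i (-1)) \notin S) || (u' (shift i 1) \notin S)) ->
  #|S| <= m.+2 + m.+2 %/ 4.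
Proof.
move=> topS free.
pose a (j : 'I_m.+2) := u j \in S; pose p (j : 'I_m.+2) := u' j \notin S.
pose c (j : 'I_m.+2) := [&& a j, ~~ a (shift j 1), ~~ a (shift j 2), a (shift j 3),
  ~~ p j, ~~ p (shift j 1), ~~ p (shift j 2) & ~~ p (shift j 3)].
have window i :
    a (shift i 1) + a (shift i 2) + a (shift i 3) + a (shift i 4) + c i
  <= 1 + c (shift i 1)
     + (p (shift i 1) + p (shift i 2) + p (shift i 3) + p (shift i 4)).
  have := @window_bound (fun k => a (shift i k%:Z)) (fun k => p (shift i k%:Z)).
  rewrite /c !shiftD shift0; apply => k.
  - apply/implyP => /free; rewrite !shiftD /p.
    have -> : (k.+1%:Z + -1 = k%:Z)%R by lia.
    by have -> : (k.+1%:Z + 1 = k.+2%:Z)%R by lia.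
  - apply/implyP => /andP[a1 a2]; apply/andP; split.
    + have := @base_pair_copy (shift i k.+2%:Z) (-1)%R (or_intror erefl) a2.
      rewrite !shiftD.
      have -> : (k.+2%:Z + -1 = k.+1%:Z)%R by lia.
      have -> : (k.+2%:Z + (-1 + -1) = k%:Z)%R by lia.
      exact.
    + have := @base_pair_copy (shift i k.+1%:Z) 1%R (or_introl erefl) a1.
      rewrite !shiftD.
      have -> : (k.+1%:Z + 1 = k.+2%:Z)%R by lia.
      have -> : (k.+1%:Z + (1 + 1) = k.+3%:Z)%R by lia.
      exact.
  - apply/implyP => /and3P[a0 a1 a3].
    have := @base_triple (shift i k%:Z) 1%R (or_introl erefl) a0.
    rewrite !shiftD.
    have -> : (k%:Z + 1 = k.+1%:Z)%R by lia.
    have -> : (k%:Z + (1 + 1 + 1) = k.+3%:Z)%R by lia.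
    by move=> /(_ a1 a3)[].
  - apply/implyP => /and3P[a0 a2 a3].
    have := @base_triple (shift i k.+3%:Z) (-1)%R (or_intror erefl) a3.
    rewrite !shiftD.
    have -> : (k.+3%:Z + -1 = k.+2%:Z)%R by lia.
    have -> : (k.+3%:Z + (-1 + -1 + -1) = k%:Z)%R by lia.
    by move=> /(_ a2 a0)[].
(* Summing over all starting points counts each index four times and cancels [c], giving 4|A| <= n +
   4|P|, where |S| = |A| + n - |P|. *)
have := leq_sum (index_enum _) (P := xpredT) (fun i _ => window i).
rewrite !big_split /= !(sum_shift (fun j => nat_of_bool (a j))).
rewrite !(sum_shift (fun j => nat_of_bool (p j))).
rewrite !(sum_shift (fun j => nat_of_bool (c j))) sum_nat_const card_ord muln1.
have -> : \sum_i nat_of_bool (a i) = #|[set i | a i]|.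
  by rewrite -sum1_card [RHS]big_mkcond; apply: eq_bigr => i _; rewrite inE; case: (a i).
have -> : \sum_i nat_of_bool (p i) = #|[set i | p i]|.
  by rewrite -sum1_card [RHS]big_mkcond; apply: eq_bigr => i _; rewrite inE; case: (p i).
have cardP : #|[set i | p i]| + #|[set i | u' i \in S]| = m.+2.
  rewrite -[RHS]card_ord -(cardsC [set i | u' i \in S]) addnC; congr (_ + _).
  by apply: eq_card => i; rewrite !inE.
have cardS : #|S| = #|[set i | a i]| + #|[set i | u' i \in S]|.
  by rewrite card_option_sum (negbTE topS).
rewrite cardS; move: cardP; set t := \sum_i _; lia.
Qed.

Lemma mutual_visibility_bound : #|S| <= m.+2 + m.+2 %/ 4.
Proof.
have [topS|topS] := boolP (v* \in S).
  by apply: leq_trans (apex_bound topS) _; lia.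
have [/forallP free|] := boolP [forall i, (u i \in S) ==>
    ((u' (shift i (-1)) \notin S) || (u' (shift i 1) \notin S))].
  by apply: discharging_bound => // i; apply/implyP.
rewrite negb_forall => /existsP[i]; rewrite negb_imply negb_or !negbK.
move=> /and3P[ai bN b1].
(* For n = 8 this is tight: n + n / 4 = 10. *)
by apply: leq_trans (isolated_bound topS ai b1 bN) _; lia.
Qed.

End UpperBound.

(** * Lower bound *)

Section LowerBound.
Variables A P : {set 'I_m.+2}.
Hypothesis A_indep : forall i j, i \in A -> j \in A -> ~~ @cycle_rel m.+2 i j.
Hypothesis A_free : forall i, i \in A -> exists2 j, @cycle_rel m.+2 i j & j \in P.

(** The copies indexed by [P] stay outside the set, serving as gates through which vertices of [A]
    reach [v*]. *)
Definition visibility_witness : {set M} :=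
  [set x : M | match x with
    | Some (inl i) => i \in A
    | Some (inr i) => i \notin P
    | None => false
    end].
Local Notation W := visibility_witness.

Lemma shift_notin_A i y z (e : int) : (e = 1 \/ e = -1)%R -> z = (y + e)%R ->
  shift i y \in A -> u (shift i z) \notin W.
Proof.
move=> he ->; rewrite -shiftD => iA; rewrite inE; apply/negP => /(A_indep iA).
by rewrite cycle_adjE; case: he => ->; rewrite eqxx ?orbT.
Qed.

Lemma visible_copies i j : i != j -> visible W (u' i) (u' j).
Proof.
move=> ij; apply: (@visible_of_minimal_walk _ _ _ _ [:: v*; u' j]) => //.
  case=> [|[[k|k]|] [|? ?]] //=; walk.
  by rewrite eqxx in ij.
by move=> z; rewrite !inE => /eqP->.
Qed.

Lemma visible_adj x y : @adj M x y -> visible W x y.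
Proof.
move=> xy; apply: (@visible_of_minimal_walk _ _ _ _ [:: y]) => //.
  by rewrite /= andbT.
by case=> //= _ e; move: xy; rewrite e adj_irrefl.
Qed.

Lemma visible_base_copy0 i : i \in A -> visible W (u i) (u' i).
Proof.
rewrite -(shift0 i) => iA.
apply: (@visible_of_minimal_walk _ _ _ _ [:: u (shift i 1); u' (shift i 0)]) => //.
- by rewrite /= !cycle_adjE !shiftD !eqxx orbT.
- by case=> [|[[k|k]|] [|? ?]] //=; walk.
- move=> z; rewrite inE => /eqP->.
  exact: (shift_notin_A (or_introl erefl) erefl iA).
Qed.

Lemma visible_base_copy2 i (e : int) : (e = 1 \/ e = -1)%R -> i \in A ->
  visible W (u i) (u' (shift i (e + e))).
Proof.
move=> he; rewrite -{1 2}(shift0 i) => iA.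
apply: (@visible_of_minimal_walk _ _ _ _
  [:: u (shift i e); u' (shift i (e + e))]) => //.
- by rewrite /= !cycle_adjE !shiftD add0r; case: he => ->; rewrite !eqxx ?orbT.
- by case: he => ->; case=> [|[[k|k]|] [|? ?]] //=; walk.
- move=> z; rewrite inE => /eqP->.
  by apply: (shift_notin_A he _ iA); rewrite add0r.
Qed.

Lemma visible_base2 i (e : int) : (e = 1 \/ e = -1)%R -> i \in A ->
  visible W (u i) (u (shift i (e + e))).
Proof.
move=> he; rewrite -{1 2}(shift0 i) => iA.
apply: (@visible_of_minimal_walk _ _ _ _
  [:: u (shift i e); u (shift i (e + e))]) => //.
- by rewrite /= !cycle_adjE !shiftD add0r; case: he => ->; rewrite !eqxx ?orbT.
- by case: he => ->; case=> [|[[k|k]|] [|? ?]] //=; walk.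
- move=> z; rewrite inE => /eqP->.
  by apply: (shift_notin_A he _ iA); rewrite add0r.
Qed.

(** Each inner vertex of the cycle route neighbours an endpoint in [A], so independence keeps it
    outside [W]. *)
Lemma visible_base3 i (e : int) : (e = 1 \/ e = -1)%R ->
  i \in A -> shift i (e + e + e) \in A -> visible W (u i) (u (shift i (e + e + e))).
Proof.
move=> he; rewrite -{1 3}(shift0 i) => iA jA.
apply: (@visible_of_minimal_walk _ _ _ _
  [:: u (shift i e); u (shift i (e + e)); u (shift i (e + e + e))]) => //.
- by rewrite /= !cycle_adjE !shiftD add0r; case: he => ->; rewrite !eqxx ?orbT.
- by case: he jA => -> _; case=> [|[[k|k]|] [|[[l|l]|] [|? ?]]] //=; walk.
- move=> z; rewrite /internal_vertices /= in_cons mem_seq1 => /orP[]/eqP->.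
    by apply: (shift_notin_A he _ iA); rewrite add0r.
  apply: (@shift_notin_A _ (e + e + e)%R _ (- e)%R _ _ jA); last by rewrite addrK.
  by case: he => ->; [right | left].
Qed.

(** The route through a gate and [v*] has length 3; a shorter walk cannot use [v*], so it moves the
    index by at most 2. *)
Lemma visible_base_copy_far i j : i \in A ->
    j \notin [seq shift i z | z <- [:: -2; -1; 0; 1; 2]%R] ->
  visible W (u i) (u' j).
Proof.
move=> iA far; have [k ik kP] := A_free iA.
apply: (@visible_of_minimal_walk _ _ _ _ [:: u' k; v*; u' j]) => //.
- by rewrite /= ik.
- clear ik; rewrite -{1 2}(shift0 i).
  case=> [|[[k1|k1]|] [|[[l|l]|] [|? ?]]] //=; walk;
    by case/negP: far; rewrite ?shiftD; apply: (map_f (shift i)).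
- by move=> z; rewrite !inE => /orP[]/eqP-> //; rewrite kP.
Qed.

(** Two gates give a route of length 4; a shorter walk misses [v*] and moves the index by at most
    3. *)
Lemma visible_base_far i j : i \in A -> j \in A ->
    j \notin [seq shift i z | z <- [:: -3; -2; -1; 0; 1; 2; 3]%R] ->
  visible W (u i) (u j).
Proof.
move=> iA jA far; have [k ik kP] := A_free iA; have [l jl lP] := A_free jA.
apply: (@visible_of_minimal_walk _ _ _ _ [:: u' k; v*; u' l; u j]) => //.
- by rewrite /= ik cycle_rel_sym jl.
- clear ik jl; rewrite -{1 2}(shift0 i).
  case=> [|[[k1|k1]|] [|[[l1|l1]|] [|[[r|r]|] [|? ?]]]] //=; walk;
    by case/negP: far; rewrite ?shiftD; apply: (map_f (shift i)).
- by move=> z; rewrite !inE => /or3P[]/eqP-> //; rewrite ?kP ?lP.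
Qed.

Lemma visibility_witnessP : mutual_visibility_set W.
Proof.
have pos1 : (1 = 1 :> int \/ 1 = -1 :> int)%R by left.
have neg1 : (-1 = 1 :> int \/ -1 = -1 :> int)%R by right.
have base_copy i j : i \in A -> visible W (u i) (u' j).
  move=> iA.
  have [/mapP[z zl ->]|] := boolP (j \in [seq shift i z | z <- [:: -2; -1; 0; 1; 2]%R]);
    last exact: visible_base_copy_far.
  move: zl; rewrite !inE; do ![case/orP] => /eqP->.
  - exact: (visible_base_copy2 neg1).
  - by apply: visible_adj; rewrite /= cycle_adjE eqxx orbT.
  - by rewrite shift0; apply: visible_base_copy0.
  - by apply: visible_adj; rewrite /= cycle_adjE eqxx.
  - exact: (visible_base_copy2 pos1).
move=> [[i|i]|] [[j|j]|]; rewrite !inE // => iS jS ij.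
- have [/mapP[z zl jE]|] :=
      boolP (j \in [seq shift i z | z <- [:: -3; -2; -1; 0; 1; 2; 3]%R]);
    last exact: visible_base_far.
  subst j; move: zl; rewrite !inE.
  case/or4P => [/eqP e|/eqP e|/eqP e|]; last case/or4P => /eqP e; subst z.
  + exact: (visible_base3 neg1).
  + exact: (visible_base2 neg1).
  + by apply: visible_adj; rewrite /= cycle_adjE eqxx orbT.
  + by rewrite shift0 eqxx in ij.
  + by apply: visible_adj; rewrite /= cycle_adjE eqxx.
  + exact: (visible_base2 pos1).
  + exact: (visible_base3 pos1).
- exact: base_copy.
- by apply: visible_sym; apply: base_copy.
- by apply: visible_copies; apply: contra ij => /eqP->.
Qed.

Lemma card_visibility_witness : #|W| = #|A| + (m.+2 - #|P|).
Proof.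
rewrite card_option_sum inE add0n; congr (_ + _).
  by apply: eq_card => i; rewrite !inE.
have <- : #|~: P| = m.+2 - #|P| by have := cardsC P; rewrite card_ord; lia.
by apply: eq_card => i; rewrite !inE.
Qed.

End LowerBound.

(** In each block of four, 4t and 4t + 2 share the gate 4t + 1: two originals gained for one copy
    lost. *)
Lemma mutual_visibility_set_exists :
  exists2 W : {set M}, mutual_visibility_set W & m.+2 + m.+2 %/ 4 <= #|W|.
Proof.
pose k := m.+2 %/ 4.
have kn : 4 * k <= m.+2 by rewrite /k; lia.
pose A : {set 'I_m.+2} := [set inord x.*2 | x : 'I_k.*2].
pose P : {set 'I_m.+2} := [set inord (4 * x).+1 | x : 'I_k].
have valA (x : 'I_k.*2) : nat_of_ord (inord x.*2 : 'I_m.+2) = x.*2.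
  by rewrite inordK //; have := ltn_ord x; lia.
have valP y : y < k -> nat_of_ord (inord (4 * y).+1 : 'I_m.+2) = (4 * y).+1.
  by move=> yk; rewrite inordK //; lia.
(* The successor of 2x is at most 4k - 1 < n, so it does not wrap around and is odd. *)
have succ_notin (x y : 'I_k.*2) : ordS (inord x.*2 : 'I_m.+2) != inord y.*2.
  apply/eqP => /(congr1 (@nat_of_ord _)); rewrite /= !valA.
  have xk := ltn_ord x; rewrite modn_small; lia.
have A_indep i j : i \in A -> j \in A -> ~~ @cycle_rel m.+2 i j.
  move=> /imsetP[x _ ->] /imsetP[y _ ->].
  by rewrite /cycle_rel !(negbTE (succ_notin _ _)) andbF.
have A_free i : i \in A -> exists2 j, @cycle_rel m.+2 i j & j \in P.
  move=> /imsetP[x _ ->]; have xk := ltn_ord x.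
  have yk : x./2 < k by lia.
  (* The index 2x is 4(x / 2) or 4(x / 2) + 2 according to the parity of x; the gate lies next to
     either. *)
  exists (inord (4 * x./2).+1); last by apply/imsetP; exists (Ordinal yk).
  rewrite /cycle_rel -!val_eqE /= !valA !valP //.
  have [ox|ox] := boolP (odd x).
    rewrite (@modn_small (4 * x./2).+2); lia.
  rewrite (@modn_small x.*2.+1); lia.
exists (visibility_witness A P); first exact: visibility_witnessP.
rewrite card_visibility_witness card_imset ?card_ord; last first.
  move=> x y /(congr1 (@nat_of_ord _)); rewrite !valA => xy.
  by apply: val_inj => /=; lia.
have : #|P| <= k by rewrite (leq_trans (leq_imset_card _ _)) ?card_ord.
rewrite -/k; lia.
Qed.

End CycleMycielskian.

(** * Combination of the two bounds *)

Theorem theorem5p2 (n : nat) (hn : 8 <= n) :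
  mu (mycielskian (cycle_graph n)) = n + n %/ 4.
Proof.
case: n hn => [|[|m]] // hn; apply/eqP; rewrite eqn_leq; apply/andP; split.
  by apply/bigmax_leqP => S /asboolP; apply: mutual_visibility_bound.
have [W Wvis leW] := mutual_visibility_set_exists hn.
by apply: leq_trans leW _; apply: leq_bigmax_cond; apply/asboolP.
Qed.
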